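(* Let $R$ be a valuation ring with maximal ideal $P$, and let $Z$ be the set of zero-divisors of $R$. The following conditions are equivalent: (1) $Z=P$; (2) each singly projective $R$-module is a content module.
   Context: A valuation ring is a commutative ring $R$ (possibly with zero-divisors) whose set of ideals is totally ordered by inclusion. $Z=\{s\in R\mid \exists\, 0\ne x\in R,\ sx=0\}$ (it is a prime ideal). An $R$-module $M$ is singly projective if, for any cyclic submodule $N$ of $M$, the inclusion map $N\to M$ factors through a free module. For $x\in M$, the content ideal $\mathrm{c}(x)$ is the intersection of all ideals $A$ of $R$ for which $x\in AM$; $M$ is a content module if $x\in\mathrm{c}(x)M$ for all $x\in M$. *)

(* Defs.v *)
From HB Require Import structures.
From mathcomp Require Import all_boot all_algebra.
From mathcomp Require Import boolp classical_sets.

Set Implicit Arguments.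
Unset Strict Implicit.
Unset Printing Implicit Defensive.

Import GRing.Theory.

Local Open Scope classical_set_scope.
Local Open Scope ring_scope.

Section Rings.
Variable R : comNzRingType.

Definition is_ideal (A : set R) : Prop :=
  A 0 /\ forall r a b : R, A a -> A b -> A (r * a + b).

Definition is_maximal_ideal (P : set R) : Prop :=
  [/\ is_ideal P, P <> setT &
      forall A : set R, is_ideal A -> P `<=` A -> A = P \/ A = setT].

Definition is_valuation_ring : Prop :=
  forall A B : set R, is_ideal A -> is_ideal B -> A `<=` B \/ B `<=` A.

(* 0 is included, since R is nonzero. *)
Definition zero_divisors : set R :=
  [set s | exists2 x : R, x != 0 & s * x = 0].

End Rings.

Arguments zero_divisors : clear implicits.

Section Modules.
Variable R : comNzRingType.

Definition is_cyclic_module (N : lmodType R) : Prop :=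
  exists x : N, forall y : N, exists r : R, y = r *: x.

Definition is_basis (F : lmodType R) (B : set F) : Prop :=
  (forall (s : seq F) (c : F -> R), uniq s -> (forall b, b \in s -> B b) ->
     \sum_(b <- s) c b *: b = 0 -> forall b, b \in s -> c b = 0) /\
  (forall y : F, exists (s : seq F) (c : F -> R),
     (forall b, b \in s -> B b) /\ y = \sum_(b <- s) c b *: b).

Definition is_free_module (F : lmodType R) : Prop :=
  exists B : set F, is_basis B.

(* A submodule of M is a subLmodType S of M; its inclusion map is \val. *)
Definition is_singly_projective (M : lmodType R) : Prop :=
  forall (S : pred M) (N : subLmodType S), is_cyclic_module N ->
    exists (F : lmodType R) (f : {linear N -> F}) (g : {linear F -> M}),
      is_free_module F /\ forall y : N, g (f y) = \val y.

(* The submodule A M, whose elements are the finite sums of products a *: m. *)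
Definition ideal_smul (A : set R) (M : lmodType R) : set M :=
  [set x | exists (n : nat) (a : 'I_n -> R) (m : 'I_n -> M),
     (forall i, A (a i)) /\ x = \sum_(i < n) a i *: m i].

Definition content (M : lmodType R) (x : M) : set R :=
  \bigcap_(A in [set A : set R | is_ideal A /\ ideal_smul A x]) A.

Definition is_content_module (M : lmodType R) : Prop :=
  forall x : M, ideal_smul (content x) x.

End Modules.

(* Main.v *)
(** Over a valuation ring, an element [x] of a singly projective module can be
    written [x = a y] with [ann x = ann a].  If [Z = P], then [ann (p a)] is
    strictly larger than [ann a] for all [p] in [P] and [a != 0]; hence [x] lies
    in no [A M] with [A] strictly smaller than [R a], so that [c(x) = R a].
    Conversely, if [s] in [P] is regular, then [R[1/s]] is singly projective,
    since [ann (r / s ^ n) = ann r].  The content of [1] in it is contained in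
    every [R s ^ n], so [1] in [c(1) R[1/s]] would make [s] a unit. *)
Require Import Defs.
From HB Require Import structures.
From mathcomp Require Import all_boot all_algebra.
From mathcomp Require Import boolp classical_sets.

Set Implicit Arguments.
Unset Strict Implicit.
Unset Printing Implicit Defensive.

Import GRing.Theory.

Local Open Scope classical_set_scope.
Local Open Scope ring_scope.
Local Open Scope quotient_scope.

(** * Divisibility in a valuation ring *)

Section ValuationRing.
Variables (R : comNzRingType) (hR : is_valuation_ring R).

Definition principal (a : R) : set R := [set x | exists t, x = t * a].

Lemma principal_ideal (a : R) : is_ideal (principal a).
Proof.
split; first by exists 0; rewrite mul0r.
move=> r _ _ [t ->] [u ->]; exists (r * t + u).
by rewrite mulrDl mulrA.
Qed.

Lemma principal_id (a : R) : principal a a.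
Proof. by exists 1; rewrite mul1r. Qed.

Lemma ideal_mull (A : set R) (r a : R) : is_ideal A -> A a -> A (r * a).
Proof. by move=> [A0 AD] Aa; rewrite -[r * a]addr0; apply: AD. Qed.

Lemma ideal_unit (A : set R) (u v : R) :
  is_ideal A -> A v -> u * v = 1 -> A = setT.
Proof.
move=> iA Av uv; apply/seteqP; split=> // x _.
by rewrite -[x]mulr1 -uv mulrA; apply: ideal_mull.
Qed.

Lemma valuation_dvd (a b : R) : principal b a \/ principal a b.
Proof.
have [ab|ba] := hR (principal_ideal a) (principal_ideal b).
  by left; apply/ab/principal_id.
by right; apply/ba/principal_id.
Qed.

Lemma valuation_unit (P : set R) (p : R) :
  is_maximal_ideal P -> ~ P p -> exists u, u * p = 1.
Proof.
move=> [iP _ maxP] nPp.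
have [pP|Pp] := hR (principal_ideal p) iP.
  by case: nPp; apply/pP/principal_id.
have [eP|eT] := maxP _ (principal_ideal p) Pp.
  by case: nPp; rewrite -eP; apply: principal_id.
have [u u1] : principal p 1 by rewrite eT.
by exists u.
Qed.

(** Divisibility is total, so one of finitely many elements divides all the others. Recording that
    [a] is itself one of the [c i] (or 0, when [s] is empty) lets membership in an ideal, or being
    killed by a scalar, pass from the [c i] to [a]. *)
Lemma valuation_gcd (I : eqType) (s : seq I) (c : I -> R) :
  exists (a : R) (d : I -> R),
    (a = 0 \/ exists2 i, i \in s & a = c i) /\
    forall i, i \in s -> c i = d i * a.
Proof.
suff [a [ha dvd_a]] : exists a, (a = 0 \/ exists2 i, i \in s & a = c i) /\
    forall i, i \in s -> exists d, c i = d * a.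
  have /choice[d hd] : forall i, exists d, i \in s -> c i = d * a.
    move=> i; have [/dvd_a[d cid]|_] := boolP (i \in s); first by exists d.
    by exists 0.
  by exists a, d.
elim: s => [|i s [a [ha dvd_a]]]; first by exists 0; split; [left|].
have [[t et]|[t et]] := valuation_dvd (c i) a.
  exists a; split.
    case: ha => [->|[j js ->]]; [by left|right; exists j => //].
    by rewrite inE js orbT.
  by move=> j /predU1P[->|/dvd_a //]; exists t.
exists (c i); split; first by right; exists i; rewrite ?mem_head.
move=> j /predU1P[->|/dvd_a[d ->]]; first by exists 1; rewrite mul1r.
by exists (d * t); rewrite et mulrA.
Qed.

(** Factoring the gcd of the coefficients out of a finite sum leaves a single product, and this gcd
    stays in [A] because it is 0 or one of the coefficients. *)
Lemma ideal_smul_scale (M : lmodType R) (A : set R) (x : M) :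
  is_ideal A -> ideal_smul A x -> exists2 b, A b & exists z, x = b *: z.
Proof.
move=> [A0 AD] [n [a [m [Aa ->]]]].
have [b [d [hb ad]]] := valuation_gcd (enum 'I_n) a.
exists b; first by case: hb => [->|[i _ ->]].
exists (\sum_(i < n) d i *: m i); rewrite scaler_sumr.
apply: eq_bigr => i _.
by rewrite ad ?mem_enum// scalerA mulrC.
Qed.

End ValuationRing.

Lemma scale_ideal_smul (R : comNzRingType) (M : lmodType R) (A : set R)
  (a : R) (y : M) : A a -> ideal_smul A (a *: y).
Proof.
move=> Aa; exists 1%N, (fun=> a), (fun=> y).
by rewrite big_ord_recl big_ord0 addr0.
Qed.

(** * The submodule generated by one element *)

Section CyclicSubmodule.
Variables (R : comNzRingType) (M : lmodType R) (x : M).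

(** Membership in [R x] is made boolean classically, since a [subLmodType] is carved out by a
    [pred]. *)
Definition cyclic_pred : pred M := fun y => `[< exists r, y = r *: x >].

Fact cyclic_submod_closed : submod_closed cyclic_pred.
Proof.
split; first by apply/asboolP; exists 0; rewrite scale0r.
move=> r _ _ /asboolP[t ->] /asboolP[u ->]; apply/asboolP.
by exists (r * t + u); rewrite scalerDl scalerA.
Qed.

HB.instance Definition _ :=
  GRing.isSubmodClosed.Build R M cyclic_pred cyclic_submod_closed.

Definition cyclic_submod := {y : M | cyclic_pred y}.
HB.instance Definition _ := SubChoice.on cyclic_submod.
HB.instance Definition _ := [SubChoice_isSubLmodule of cyclic_submod by <:].

Fact cyclic_pred_id : cyclic_pred x.
Proof. by apply/asboolP; exists 1; rewrite scale1r. Qed.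

Definition cyclic_gen : cyclic_submod := Sub x cyclic_pred_id.

Lemma cyclic_submod_cyclic : is_cyclic_module cyclic_submod.
Proof.
exists cyclic_gen => y; have /asboolP[r yr] := valP y.
by exists r; apply: val_inj; rewrite yr linearZ.
Qed.

End CyclicSubmodule.

(** * An elementwise criterion for singly projective modules *)

Section SinglyProjective.
Variable R : comNzRingType.

Lemma regular_free : is_free_module (R^o : lmodType R).
Proof.
exists [set 1]; split=> [s c us s1 sum0 b bs|y].
  have eb := s1 _ bs; move: sum0.
  rewrite (bigD1_seq b)//= big_seq_cond big1 ?addr0.
    by rewrite eb => <-; rewrite -[c 1 in LHS]mulr1.
  by move=> i /andP[/s1 ->]; rewrite eb eqxx.
exists [:: 1], (fun=> y); split; first by move=> b; rewrite inE => /eqP.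
by rewrite big_seq1 -[LHS]mulr1.
Qed.

(** Factor the inclusion of [R x] through a free module and let [a] be the gcd of the coordinates of
    the image of [x]. A scalar that kills [x] kills every coordinate by independence, hence kills
    [a], which is 0 or a coordinate. *)
Lemma singly_projective_scale (M : lmodType R) (x : M) :
  is_valuation_ring R -> is_singly_projective M ->
  exists (a : R) (y : M), x = a *: y /\ forall r, r *: x = 0 -> r * a = 0.
Proof.
move=> hR /(_ _ _ (cyclic_submod_cyclic x)) [F [f [g [[B [indep gen]] gf]]]].
have [s [c [sB fx]]] := gen (f (cyclic_gen x)).
(* The list given by generation may repeat basis elements, whereas independence speaks of
   duplicate-free lists; multiplicities are absorbed into the coefficients. *)
have {}fx : f (cyclic_gen x) =
    \sum_(b <- undup s) (c b *+ count_mem b s) *: b.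
  rewrite fx -big_undup_iterop_count; apply: eq_bigr => b _.
  exact: scalerMnl.
have [a [d [ha cd]]] := valuation_gcd hR (undup s)
  (fun b => c b *+ count_mem b s).
exists a, (\sum_(b <- undup s) d b *: g b); split.
  rewrite -[LHS](gf (cyclic_gen x)) fx linear_sum scaler_sumr.
  by apply: eq_big_seq => b bs; rewrite linearZ cd//= scalerA mulrC.
move=> r rx; case: ha => [->|[b bs ->]]; first by rewrite mulr0.
apply: (indep (undup s) (fun b => r * (c b *+ count_mem b s))) => //.
- exact: undup_uniq.
- by move=> i; rewrite mem_undup; apply: sB.
- under eq_bigr do rewrite -scalerA.
  rewrite -scaler_sumr -fx -linearZ.
  suff -> : r *: cyclic_gen x = 0 by rewrite linear0.
  by apply: val_inj; rewrite linearZ linear0.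
Qed.

(** The free module can be [R] itself: the annihilator condition makes [r *: x] to [r * a] well
    defined on [R x], and [t] to [t *: y] brings it back into [M]. *)
Lemma scale_singly_projective (M : lmodType R) :
  (forall x : M, exists (a : R) (y : M),
     x = a *: y /\ forall r, r *: x = 0 -> r * a = 0) ->
  is_singly_projective M.
Proof.
move=> hM S N [x /choice[c xc]].
have [a [y [xay ann_x]]] := hM (\val x).
(* The coefficient [c z] is an arbitrary choice and need not be linear in [z]; only its product with
   [a] is independent of the choice. *)
have ca r z : z = r *: x -> c z * a = r * a.
  move=> zr; apply/eqP; rewrite -subr_eq0 -mulrBl; apply/eqP/ann_x.
  by rewrite -linearZ scalerBl -xc -zr subrr linear0.
pose f (z : N) : R^o := c z * a.
have f_lin : linear f.
  move=> r u v; rewrite /f (ca (r * c u + c v)).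
    by rewrite mulrDl -mulrA.
  by rewrite scalerDl -scalerA -!xc.
pose g (t : R^o) : M := t *: y.
have g_lin : linear g.
  by move=> r u v; rewrite /g scalerDl -scalerA.
pose fM := GRing.isLinear.Build R N R^o _ f f_lin.
pose fL : {linear N -> R^o} := HB.pack f fM.
pose gM := GRing.isLinear.Build R R^o M _ g g_lin.
pose gL : {linear R^o -> M} := HB.pack g gM.
exists R^o, fL, gL; split; first exact: regular_free.
by move=> z; rewrite /= /g /f -scalerA -xay -linearZ -xc.
Qed.

End SinglyProjective.

(** * The localization [R[1/s]] at a regular element, as an [R]-module *)

Section Localization.
Variables (R : comNzRingType) (s : R) (hs : GRing.lreg s).

(** A pair [(n, r)] stands for [r / s ^ n]. As [s] is regular, plain cross-multiplication is already
    transitive. *)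
Definition frac_eq (u v : nat * R) := s ^+ v.1 * u.2 == s ^+ u.1 * v.2.

Fact frac_eq_equiv : equiv_class_of frac_eq.
Proof.
split=> [u|u v|v u w]; rewrite /frac_eq ?eqxx//.
move=> /eqP uv /eqP vw; apply/eqP; apply: (@lregX _ s v.1 hs) => /=.
by rewrite mulrCA uv mulrCA vw mulrCA.
Qed.

Canonical frac_equiv := EquivRelPack frac_eq_equiv.

Definition loc := {eq_quot frac_equiv}.
HB.instance Definition _ := Choice.on loc.
HB.instance Definition _ := EqQuotient.on loc.

Definition frac (n : nat) (r : R) : loc := \pi_loc (n, r).

Lemma fracP n r m t : frac n r = frac m t <-> s ^+ m * r = s ^+ n * t.
Proof. by split=> [/eqmodP/eqP|e]; [|apply/eqmodP/eqP]. Qed.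

Lemma loc_ind (Q : loc -> Prop) : (forall n r, Q (frac n r)) -> forall x, Q x.
Proof. by move=> hQ x; rewrite -[x]reprK; case: (repr x). Qed.

Definition loc_add (x y : loc) : loc :=
  frac ((repr x).1 + (repr y).1)
    (s ^+ (repr y).1 * (repr x).2 + s ^+ (repr x).1 * (repr y).2).
Definition loc_scale (a : R) (x : loc) : loc := frac (repr x).1 (a * (repr x).2).

(** The chosen representative of [frac n r] need not be [(n, r)]; this relation is enough to compute
    the operations on arbitrary fractions. *)
Lemma repr_frac n r :
  s ^+ n * (repr (frac n r)).2 = s ^+ (repr (frac n r)).1 * r.
Proof. by apply/fracP; rewrite /frac -surjective_pairing reprK. Qed.

Lemma loc_addE n r m t :
  loc_add (frac n r) (frac m t) = frac (n + m) (s ^+ m * r + s ^+ n * t).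
Proof.
apply/fracP; have := repr_frac n r; have := repr_frac m t.
case: (repr (frac n r)) => n' r'; case: (repr (frac m t)) => m' t' /= et er.
rewrite !mulrDr !exprD; congr (_ + _).
  rewrite [s ^+ n * _]mulrC mulrACA er [s ^+ m * s ^+ m']mulrC mulrACA.
  by rewrite [s ^+ m' * _]mulrC.
by rewrite mulrACA et [s ^+ n * s ^+ n']mulrC mulrACA.
Qed.

Lemma loc_scaleE a n r : loc_scale a (frac n r) = frac n (a * r).
Proof. by apply/fracP; rewrite !(mulrCA _ a) repr_frac. Qed.

Fact loc_addA : associative loc_add.
Proof.
elim/loc_ind=> n r; elim/loc_ind=> m t; elim/loc_ind=> k u.
rewrite !loc_addE addnA; congr frac.
by rewrite !mulrDr !mulrA -!exprD addrA !(addnC k).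
Qed.

Fact loc_addC : commutative loc_add.
Proof.
elim/loc_ind=> n r; elim/loc_ind=> m t.
by rewrite !loc_addE addnC addrC.
Qed.

Fact loc_add0 : left_id (frac 0 0) loc_add.
Proof.
by elim/loc_ind=> n r; rewrite loc_addE mulr0 add0r mul1r.
Qed.

Fact loc_addN : left_inverse (frac 0 0) (loc_scale (-1)) loc_add.
Proof.
elim/loc_ind=> n r; rewrite loc_scaleE loc_addE; apply/fracP.
by rewrite mulN1r mulrN addNr !mulr0.
Qed.

HB.instance Definition _ :=
  GRing.isZmodule.Build loc loc_addA loc_addC loc_add0 loc_addN.

Lemma add_frac n r m t :
  frac n r + frac m t = frac (n + m) (s ^+ m * r + s ^+ n * t).
Proof. exact: loc_addE. Qed.

Fact loc_scaleA a b x : loc_scale a (loc_scale b x) = loc_scale (a * b) x.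
Proof. by elim/loc_ind: x => n r; rewrite !loc_scaleE mulrA. Qed.

Fact loc_scale1 : left_id 1 loc_scale.
Proof. by elim/loc_ind=> n r; rewrite loc_scaleE mul1r. Qed.

Fact loc_scaleDr : right_distributive loc_scale +%R.
Proof.
move=> a; elim/loc_ind=> n r; elim/loc_ind=> m t.
by rewrite add_frac !loc_scaleE add_frac mulrDr !(mulrCA a).
Qed.

Fact loc_scaleDl x : {morph loc_scale^~ x : a b / a + b}.
Proof.
elim/loc_ind: x => n r a b; rewrite !loc_scaleE add_frac; apply/fracP.
by rewrite mulrDl -mulrDr exprD -mulrA.
Qed.

HB.instance Definition _ := GRing.Zmodule_isLmodule.Build R loc
  loc_scaleA loc_scale1 loc_scaleDr loc_scaleDl.

Lemma scale_frac a n r : a *: frac n r = frac n (a * r).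
Proof. exact: loc_scaleE. Qed.

Lemma frac_eq0 n r : frac n r = 0 -> r = 0.
Proof. by move/fracP; rewrite mul1r mulr0. Qed.

Lemma loc_singly_projective : is_singly_projective loc.
Proof.
apply: scale_singly_projective; elim/loc_ind=> n r.
exists r, (frac n 1); rewrite scale_frac mulr1; split=> // t.
by rewrite scale_frac => /frac_eq0.
Qed.

Lemma loc_content_unit :
  is_valuation_ring R -> is_content_module loc -> exists u, u * s = 1.
Proof.
move=> hR /(_ (frac 0 1)) c1.
have c_ideal : is_ideal (content (frac 0 1)).
  split=> [A [[]]//|r a b ca cb A hA].
  by case: (hA) => -[_ AD] _; apply: AD; [apply: ca|apply: cb].
have [b cb [z]] := ideal_smul_scale hR c_ideal c1.
elim/loc_ind: z => n r; rewrite scale_frac => /fracP.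
rewrite mulr1 mul1r => sn.
(* Here [s ^ n = b * r]. The exponent is one more than that of the denominator of [z], so that a
   factor [s] survives the cancellation of [s ^ n]. *)
have [t bt] : principal (s ^+ n.+1) b.
  apply: cb; split; first exact: principal_ideal.
  have -> : frac 0 1 = s ^+ n.+1 *: frac n.+1 1.
    by rewrite scale_frac; apply/fracP; rewrite mulr1 mul1r.
  exact/scale_ideal_smul/principal_id.
exists (t * r); apply: (@lregX _ s n hs).
by rewrite mulr1 [RHS]sn bt exprSr -!mulrA mulrCA (mulrC r).
Qed.

End Localization.

(** * The two implications *)

Lemma zero_divisors_maximal_content (R : comNzRingType) (P : set R) :
  is_valuation_ring R -> is_maximal_ideal P -> zero_divisors R = P ->
  forall M : lmodType R, is_singly_projective M -> is_content_module M.
Proof.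
move=> hR hP ZP M spM x.
have [a [y [xay ann_x]]] := singly_projective_scale x hR spM.
suff ca : content x a by rewrite [x in ideal_smul _ x]xay; apply: scale_ideal_smul.
move=> A [iA /(ideal_smul_scale hR iA) [b Ab [z xbz]]].
(* If [b] divides [a], or [b = p * a] with [p] a unit, then [a] is in [A]. Otherwise [p] is in [P],
   so some [w != 0] satisfies [p * w = 0]. *)
have [[t ->]|[p bpa]] := valuation_dvd hR a b; first exact: ideal_mull.
have [Pp|/(valuation_unit hR hP) [u up]] := pselect (P p); last first.
  by rewrite -[a]mul1r -up -mulrA -bpa; apply: ideal_mull.
move: Pp; rewrite -ZP => -[w w0 pw].
have ann_pa r : r * (p * a) = 0 -> r * a = 0.
  by move=> e; apply: ann_x; rewrite xbz bpa scalerA e scale0r.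
(* If [a] is a multiple of [w], then [p * a = 0], which forces [a = 0]. If [w = t * a], then [t]
   kills [p * a], hence [a], so [w = 0]. *)
have [[t at_]|[t wt]] := valuation_dvd hR a w.
  suff -> : a = 0 by case: iA.
  rewrite -[a]mul1r; apply: ann_pa.
  by rewrite mul1r at_ mulrCA pw mulr0.
by case/eqP: w0; rewrite wt; apply: ann_pa; rewrite mulrCA -wt.
Qed.

Theorem corollary4p4 (R : comNzRingType) (P : set R)
  (hR : is_valuation_ring R) (hP : is_maximal_ideal P) :
  zero_divisors R = P <->
  (forall M : lmodType R, is_singly_projective M -> is_content_module M).
Proof.
split; first exact: zero_divisors_maximal_content.
move=> content_sp; apply/seteqP; split=> [s [x x0 sx]|s Ps].
  (* Outside [P] every element is a unit, and a unit kills no nonzero element. *)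
  apply: contrapT => /(valuation_unit hR hP) [u us].
  by case/eqP: x0; rewrite -[x]mul1r -us -mulrA sx mulr0.
apply: contrapT => nZs.
have hs : GRing.lreg s.
  move=> a b /= ab; apply/eqP; rewrite -subr_eq0; apply/negP => /negP ab0.
  by apply: nZs; exists (a - b); rewrite // mulrBr ab subrr.
have [u us] := loc_content_unit hR (content_sp _ (@loc_singly_projective R s hs)).
by case: hP => iP PT _; apply/PT/(ideal_unit iP Ps us).
Qed.
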